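(* Let $G$ be a finite simple graph. The following assertions are equivalent: (i) $G$ is a König–Egerváry graph; (ii) there is a maximum independent set $S$ of $G$ that is critical, i.e., $\alpha_c(G)=\alpha(G)$; (iii) every maximum independent set of $G$ is critical.
   Context: A set of vertices is independent if no two of its vertices are adjacent; $\mathrm{Ind}(G)$ is the family of independent sets, $\alpha(G)$ the maximum size of an independent set, and a maximum independent set is an independent set of size $\alpha(G)$. $\mu(G)$ is the size of a maximum matching. $G$ is a König–Egerváry graph if $\alpha(G)+\mu(G)=|V(G)|$. For $S\subseteq V(G)$, $N(S)$ is the set of vertices adjacent to some vertex of $S$. The critical difference is $d(G)=\max\{|S|-|N(S)| : S\in\mathrm{Ind}(G)\}$; an independent set $A$ is critical if $|A|-|N(A)|=d(G)$; $\alpha_c(G)$ is the maximum cardinality of a critical independent set. *)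

(* Defs.v *)
(* A finite simple graph is a symmetric irreflexive
   relation [e] on a finType [T] of vertices. *)
From HB Require Import structures.
From mathcomp Require Import all_boot all_order all_algebra.

Set Implicit Arguments.
Unset Strict Implicit.
Unset Printing Implicit Defensive.

Import Order.TTheory GRing.Theory Num.Theory.

Section Graph.
Variables (T : finType) (e : rel T).
Implicit Types (S : {set T}) (M : {set {set T}}).

Definition independent S : bool :=
  [forall u in S, forall v in S, ~~ e u v].

Definition nbhd S : {set T} := [set v | [exists u in S, e u v]].

Definition alpha : nat := \max_(S : {set T} | independent S) #|S|.

Definition max_independent S : bool := independent S && (#|S| == alpha).

Definition edges : {set {set T}} :=
  [set [set p.1; p.2] | p : T * T & e p.1 p.2].

Definition matching M : bool := (M \subset edges) && trivIset M.

Definition mu : nat := \max_(M : {set {set T}} | matching M) #|M|.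

Definition konig_egervary : bool := alpha + mu == #|T|.

(* The subtraction is that of integers, not the truncated one of nat. *)
Definition difference S : int := (#|S|%:Z - #|nbhd S|%:Z)%R.

(* The initial value of the iterated maximum is the difference of the empty
   set, which is itself independent, so it adds nothing to the maximum. *)
Definition critical_difference : int :=
  \big[Order.max/difference set0]_(S : {set T} | independent S) difference S.

Definition critical S : bool :=
  independent S && (difference S == critical_difference).

Definition alpha_c : nat := \max_(S : {set T} | critical S) #|S|.

End Graph.

(* Main.v *)
(* A matching M and any set A satisfy |A| - |N(A)| <= |V| - 2|M|, since every
   edge of M meets N(A) at least as often as it meets A.  On the other hand
   N(S) is the complement of S when S is a maximum independent set, so all
   these sets have the difference 2 alpha - |V|.  In a König–Egerváry graph
   2 alpha - |V| equals |V| - 2 mu, hence the bound is attained.  Conversely,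
   if a maximum independent set S is critical, deleting from S the neighbours
   of a set B disjoint from S shows that B has at least |B| neighbours in S;
   Hall's theorem then matches the complement of S into S. *)
Require Import Defs.
From mathcomp Require Import all_boot all_order all_algebra.
From mathcomp Require Import zify.

Set Implicit Arguments.
Unset Strict Implicit.
Unset Printing Implicit Defensive.

Import Order.TTheory GRing.Theory Num.Theory.

(** * Hall's marriage theorem for finite families of finite sets *)

Section Hall.
Variables I J : finType.
Implicit Types (A : I -> {set J}) (B : {set I}).

Definition hall_condition A :=
  [forall B : {set I}, #|B| <= #|\bigcup_(i in B) A i|].

(** A set violating the condition for the reduced family must contain [x], as the two families agree
    away from [x]. Taking [x] out of it gives [B] and turns the strict inequality into a weak
    one. *)
Lemma hall_violation A x y :
    hall_condition A ->
    ~~ hall_condition (fun i => if i == x then A x :\ y else A i) ->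
  exists2 B : {set I},
    x \notin B & #|(\bigcup_(i in B) A i) :|: (A x :\ y)| <= #|B|.
Proof.
set A' := fun i => _ => /forallP hallA /forallPn[B].
rewrite -ltnNge => ltB.
have A'E C : x \notin C -> \bigcup_(i in C) A' i = \bigcup_(i in C) A i.
  move=> xC; apply: eq_bigr => i iC; rewrite /A' ifN //.
  by apply: contraNneq xC => <-.
have xB : x \in B.
  apply: contraLR ltB => xB; rewrite A'E // -leqNgt; exact: hallA.
exists (B :\ x); first by rewrite setD11.
move: ltB; rewrite (cardsD1 x B) xB (big_setD1 x xB) /= {1}/A' eqxx ltnS.
by rewrite A'E ?setD11 // setUC.
Qed.

(* Rado's argument: as long as some set has two distinct elements, one of
   them can be dropped without breaking Hall's condition: by submodularity of
   the cardinality of unions, violations B and C for the two elements would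
   contradict the condition on B :&: C and x |: (B :|: C). *)
Theorem hall_marriage A :
  hall_condition A -> exists2 f : I -> J, injective f & forall i, f i \in A i.
Proof.
have [n] := ubnP (\sum_i #|A i|); elim: n A => // n IH A leAn hall0.
have hallA B : #|B| <= #|\bigcup_(i in B) A i| by have /forallP := hall0.
have A_gt0 i : 0 < #|A i| by have := hallA [set i]; rewrite cards1 big_set1.
have [/existsP[x /card_gt1P[y [z [yA zA neq_yz]]]]|/existsPn A_le1] :=
  boolP [exists i, 1 < #|A i|].
  have drop w : w \in A x ->
      hall_condition (fun i => if i == x then A x :\ w else A i) ->
      exists2 f : I -> J, injective f & forall i, f i \in A i.
    move=> wA hall'; have [|f f_inj fA] := IH _ _ hall'.
      rewrite ltnS in leAn; apply: leq_trans leAn.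
      rewrite (bigD1 x) //= [X in _ < X](bigD1 x) //=
              eqxx (cardsD1 w (A x)) wA add1n addSn ltnS leq_add2l.
      by apply: leq_sum => i /negbTE ->.
    exists f => // i; have := fA i; case: eqP => // ->.
    by rewrite inE => /andP[].
  have [/(drop y yA) // | /(hall_violation hall0)[B xB leB]] :=
    boolP (hall_condition (fun i => if i == x then A x :\ y else A i)).
  have [/(drop z zA) // | /(hall_violation hall0)[C xC leC]] :=
    boolP (hall_condition (fun i => if i == x then A x :\ z else A i)).
  move: leB leC; set NB := _ :|: _; set NC := _ :|: _ => leB leC.
  (* Since [y != z], the sets [A x :\ y] and [A x :\ z] together cover [A x]; this is what lets [x]
     join the index set and yields the extra one. *)
  have leU : #|B :|: C|.+1 <= #|NB :|: NC|.
    have /leq_trans -> // :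
        #|B :|: C|.+1 <= #|\bigcup_(i in x |: (B :|: C)) A i|.
      by apply: leq_trans (hallA _); rewrite cardsU1 inE negb_or xB xC.
    apply/subset_leq_card/bigcupsP => i; rewrite !inE => iBC.
    apply/subsetP => j jA; rewrite !inE.
    case/or3P: iBC => [/eqP ix|iB|iC].
    - rewrite -ix jA !andbT; have [->|] := eqVneq j y; last by rewrite orbT.
      by rewrite neq_yz !orbT.
    - by apply/orP; left; apply/orP; left; apply/bigcupP; exists i.
    - by apply/orP; right; apply/orP; left; apply/bigcupP; exists i.
  have leI : #|B :&: C| <= #|NB :&: NC|.
    apply: leq_trans (hallA _) _; apply/subset_leq_card/bigcupsP => i.
    rewrite inE => /andP[iB iC]; apply/subsetP => j jA; rewrite !inE.
    by apply/andP; split; apply/orP; left; apply/bigcupP; exists i.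
  by have := cardsUI B C; have := cardsUI NB NC; lia.
have A1 i : exists j, A i == [set j].
  have /cards1P[j ->] : #|A i| == 1 by rewrite eqn_leq A_gt0 andbT leqNgt A_le1.
  by exists j.
pose f i := xchoose (A1 i).
have fE i : A i = [set f i] by apply/eqP/(xchooseP (A1 i)).
exists f => [i i' ff|i]; last by rewrite fE set11.
(* All sets are now singletons. Two distinct indices with a common value would have a union of size
   one, against Hall's condition. *)
apply/eqP; have := hallA [set i; i'].
by rewrite cards2 bigcup_setU !big_set1 !fE ff setUid cards1; case: eqVneq.
Qed.

End Hall.

(** * Independent sets, neighbourhoods and matchings *)

Section Graph.
Variables (T : finType) (e : rel T).
Hypotheses (e_sym : symmetric e) (e_irr : irreflexive e).
Implicit Types (S A : {set T}) (M : {set {set T}}).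

Lemma independentP S :
  reflect {in S &, forall u v, ~~ e u v} (independent e S).
Proof.
apply: (iffP forall_inP) => [indS u v uS vS|indS u uS].
  by move/forall_inP: (indS u uS); apply.
by apply/forall_inP => v; apply: indS.
Qed.

Lemma nbhdP S v : reflect (exists2 u, u \in S & e u v) (v \in nbhd e S).
Proof. by rewrite inE; apply: exists_inP. Qed.

Lemma edge_pair E :
  E \in edges e -> exists u v, [/\ E = [set u; v], u != v & e u v].
Proof.
case/imsetP => -[u v]; rewrite inE /= => euv ->; exists u, v; split=> //.
by apply: contraTneq euv => ->; rewrite e_irr.
Qed.

Lemma matching_bound M A : matching e M ->
  #|A| + #|M|.*2 <= #|T| + #|nbhd e A|.
Proof.
case/andP => /subsetP sM tM.
have coverE : #|cover M| = #|M|.*2.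
  rewrite -(eqP tM) -muln2 -sum_nat_const; apply: eq_bigr => E /sM.
  by case/edge_pair => u [v [-> neq_uv _]]; rewrite cards2 neq_uv.
(* The matched vertices of a set are counted edge by edge. *)
have card_cover (C : {set T}) :
    #|C :&: cover M| = \sum_(E in M) \sum_(x in E) (x \in C).
  rewrite -big_trivIset //= -sum1_card big_mkcond [RHS]big_mkcond /=.
  apply: eq_bigr => x _; rewrite inE andbC.
  by case: (x \in cover M); case: (x \in C).
have le_cover : #|A :&: cover M| <= #|nbhd e A :&: cover M|.
  rewrite !card_cover; apply: leq_sum => E /sM /edge_pair[u [v [-> neq euv]]].
  have uv : u \notin [set v] by rewrite inE.
  (* An endpoint in [A] puts the opposite endpoint in [nbhd e A], so the terms are compared
     crosswise. *)
  rewrite !big_setU1 //= !big_set1 [leqRHS]addnC; apply: leq_add.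
    case: (boolP (u \in A)) => // uA.
    by rewrite (introT (nbhdP A v)) //; exists u.
  case: (boolP (v \in A)) => // vA.
  by rewrite (introT (nbhdP A u)) //; exists v => //; rewrite e_sym.
have := cardsID (cover M) A; have := cardsC (cover M).
have := subset_leq_card (subsetIl (nbhd e A) (cover M)).
(* The unmatched vertices of [A] account for the slack [#|T| - #|M|.*2]. *)
have : #|A :\: cover M| <= #|~: cover M|.
  by rewrite setDE subset_leq_card ?subsetIr.
lia.
Qed.

(** * Extremal sets and bounds on the graph parameters *)

Lemma leq_alpha S : independent e S -> #|S| <= alpha e.
Proof.
by move=> indS; apply: (leq_bigmax_cond (F := fun S : {set T} => #|S|)).
Qed.

Lemma independent0 : independent e set0.
Proof. by apply/independentP => u v; rewrite inE. Qed.

Lemma max_independent_exists : exists S, max_independent e S.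
Proof.
have [|S indS alphaE] :=
  @eq_bigmax_cond _ (independent e) (fun S : {set T} => #|S|).
  by apply/card_gt0P; exists set0; apply: independent0.
by exists S; rewrite /max_independent /alpha alphaE eqxx andbT.
Qed.

Lemma mu_matching : exists2 M, matching e M & #|M| = mu e.
Proof.
have [|M matM muE] :=
  @eq_bigmax_cond _ (matching e) (fun M : {set {set T}} => #|M|).
  apply/card_gt0P; exists set0; rewrite unfold_in /matching sub0set.
  by rewrite /trivIset /cover !big_set0 cards0.
by exists M; rewrite // /mu muE.
Qed.

Lemma nbhd_independent S : independent e S -> nbhd e S \subset ~: S.
Proof.
move/independentP => indS; apply/subsetP => v /nbhdP[u uS euv]; rewrite inE.
by apply: contraTN euv => vS; apply: indS.
Qed.

(** A vertex outside [S] with no neighbour in [S] could be added to [S], contradicting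
    maximality. *)
Lemma nbhd_max_independent S : max_independent e S -> nbhd e S = ~: S.
Proof.
case/andP => indS /eqP cardS; apply/eqP; rewrite eqEsubset nbhd_independent //=.
apply/subsetP => v; rewrite inE => vS; apply: contraT => /nbhdP vN.
have nadj u : u \in S -> ~~ e u v.
  by move=> uS; apply/negP => euv; apply: vN; exists u.
suff /leq_alpha : independent e (v |: S) by rewrite cardsU1 vS cardS ltnn.
move/independentP: indS => indS; apply/independentP => x y.
case/setU1P => [->|xS] /setU1P[->|yS]; rewrite ?e_irr //; last exact: indS.
  by rewrite e_sym nadj.
exact: nadj.
Qed.

Lemma difference_max_independent S : max_independent e S ->
  difference e S = ((alpha e).*2%:Z - #|T|%:Z)%R.
Proof.
move=> maxS; have /andP[_ /eqP cardS] := maxS.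
rewrite /difference nbhd_max_independent //; have := cardsC S; lia.
Qed.

Lemma le_critical_difference S : independent e S ->
  (difference e S <= critical_difference e)%R.
Proof. by move=> indS; apply: le_bigmax_cond. Qed.

Lemma criticalP S :
  reflect (independent e S /\
           forall A, independent e A -> (difference e A <= difference e S)%R)
          (critical e S).
Proof.
apply: (iffP andP) => -[indS]; [move/eqP=> -> | move=> leS]; split=> //.
  exact: le_critical_difference.
rewrite eq_le le_critical_difference //=.
by apply: bigmax_le => [|A /leS //]; apply/leS/independent0.
Qed.

Lemma critical_exists : exists S, critical e S.
Proof.
have [S indS maxS] := @Order.TotalTheory.arg_maxP _ _ _ set0 (independent e)
  (difference e) independent0.
by exists S; apply/criticalP.
Qed.

Lemma leq_alpha_c S : critical e S -> #|S| <= alpha_c e.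
Proof.
by move=> critS; apply: (leq_bigmax_cond (F := fun S : {set T} => #|S|)).
Qed.

Lemma alpha_c_critical : exists2 S, critical e S & #|S| = alpha_c e.
Proof.
have [S0 critS0] := critical_exists.
have [|S critS cardS] :=
  @eq_bigmax_cond _ (critical e) (fun S : {set T} => #|S|).
  by apply/card_gt0P; exists S0.
by exists S; rewrite // /alpha_c cardS.
Qed.

Lemma leq_alpha_c_alpha : alpha_c e <= alpha e.
Proof. by apply/bigmax_leqP => S /andP[/leq_alpha]. Qed.

(** For a maximum independent set, whose neighbourhood is its complement, [matching_bound] is twice
    this inequality. *)
Lemma alpha_mu_leq : alpha e + mu e <= #|T|.
Proof.
have [S maxS] := max_independent_exists; have [M matM <-] := mu_matching.
have /andP[_ /eqP <-] := maxS.
have := matching_bound S matM; rewrite (nbhd_max_independent maxS).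
have := cardsC S; lia.
Qed.

(** * Criticality and the König-Egerváry property *)

Lemma konig_egervary_critical S :
  konig_egervary e -> max_independent e S -> critical e S.
Proof.
move=> /eqP KE maxS; apply/criticalP; split; first by case/andP: maxS.
move=> A _; rewrite (difference_max_independent maxS) /difference.
have [M matM cardM] := mu_matching; have := matching_bound A matM; lia.
Qed.

Lemma critical_expansion S (B : {set T}) :
    max_independent e S -> critical e S -> B \subset ~: S ->
  #|B| <= #|nbhd e B :&: S|.
Proof.
move=> maxS /criticalP[indS leS] sBS.
have indD : independent e (S :\: nbhd e B).
  apply/independentP => u v /setDP[uS _] /setDP[vS _].
  by move/independentP: indS; apply.
(* Passing to [S :\: nbhd e B] removes all of [B] from the neighbourhood. Were fewer than [#|B|]
   vertices of [S] deleted, the difference would grow. *)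
have sN : nbhd e (S :\: nbhd e B) \subset ~: S :\: B.
  apply/subsetP => v /nbhdP[u /setDP[uS uNB] euv]; rewrite in_setD.
  apply/andP; split.
    by apply: contra uNB => vB; apply/nbhdP; exists v; rewrite // e_sym.
  by apply: (subsetP (nbhd_independent indS)); apply/nbhdP; exists u.
have := leS _ indD; rewrite /difference (nbhd_max_independent maxS).
have := subset_leq_card sN; have := cardsID B (~: S).
rewrite (setIidPr sBS); have := cardsID (nbhd e B) S; rewrite [S :&: _]setIC.
lia.
Qed.

Lemma critical_konig_egervary S :
  max_independent e S -> critical e S -> konig_egervary e.
Proof.
move=> maxS critS; rewrite /konig_egervary eqn_leq alpha_mu_leq /=.
have [_ /eqP <-] := andP maxS.
pose I := {x | x \in ~: S}.
have [|f f_inj fP] := @hall_marriage I T (fun i => nbhd e [set val i] :&: S).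
  apply/forallP => B; rewrite -(card_imset _ val_inj).
  apply: leq_trans (critical_expansion maxS critS _) _.
    by apply/subsetP => _ /imsetP[i _ ->]; apply: valP.
  apply/subset_leq_card/subsetP => v /setIP[/nbhdP[_ /imsetP[i iB ->] eiv] vS].
  apply/bigcupP; exists i => //; rewrite in_setI vS andbT.
  by apply/nbhdP; exists (val i); rewrite ?set11.
have fS i : f i \in S by case/setIP: (fP i).
have ef (i : I) : e (val i) (f i).
  by case/setIP: (fP i) => /nbhdP[_ /set1P->].
have iS (i : I) : val i \notin S by rewrite -in_setC; apply: valP.
pose E (i : I) := [set val i; f i].
(* Each pair has [val i] outside [S] and [f i] inside, so a shared vertex plays the same role in
   both pairs, and both [val] and [f] are injective. *)
have meetE i j x : x \in E i -> x \in E j -> i = j.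
  case/set2P => -> /set2P[].
  - exact: val_inj.
  - by move=> ij; have := iS i; rewrite ij fS.
  - by move=> ij; have := iS j; rewrite -ij fS.
  - exact: f_inj.
have E_inj : injective E.
  by move=> i j Eij; apply: (meetE i j (val i)); rewrite -?Eij set21.
have matE : matching e [set E i | i : I].
  apply/andP; split.
    apply/subsetP => _ /imsetP[i _ ->].
    by apply/imsetP; exists (val i, f i); rewrite ?inE /= ?ef.
  apply/trivIsetP => _ _ /imsetP[i _ ->] /imsetP[j _ ->].
  apply: contraR => /pred0Pn[x /andP[xi xj]].
  by rewrite (meetE i j x).
have : #|[set E i | i : I]| <= mu e.
  exact: (leq_bigmax_cond (F := fun M : {set {set T}} => #|M|)).
rewrite card_imset // card_sig => le_mu.
by rewrite -(cardsC S) leq_add2l.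
Qed.

End Graph.

Theorem theorem6 (T : finType) (e : rel T)
    (e_sym : symmetric e) (e_irr : irreflexive e) :
  [<-> konig_egervary e;
       exists S : {set T}, max_independent e S /\ critical e S;
       alpha_c e = alpha e;
       forall S : {set T}, max_independent e S -> critical e S].
Proof.
(* The universal last condition gives the first one only through an actual maximum independent
   set. *)
have [S0 maxS0] := max_independent_exists e.
tfae.
- by move=> KE; exists S0; split; last exact: konig_egervary_critical.
- move=> [S [/andP[_ /eqP cardS] critS]]; apply/eqP.
  by rewrite eqn_leq leq_alpha_c_alpha -cardS leq_alpha_c.
(* A largest critical set [A] is here maximum independent, and all such sets share one difference,
   so [S] inherits criticality from [A]. *)
- move=> alpha_cE S maxS; have [A critA cardA] := alpha_c_critical e.
  have maxA : max_independent e A.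
    have /andP[indA _] := critA.
    by rewrite /max_independent indA cardA alpha_cE eqxx.
  have /criticalP[_ leA] := critA.
  apply/criticalP; split=> [|B /leA]; first by case/andP: maxS.
  rewrite (difference_max_independent e_sym e_irr maxA).
  by rewrite (difference_max_independent e_sym e_irr maxS).
- move=> allcrit; apply: (critical_konig_egervary e_sym e_irr maxS0).
  exact: allcrit.
Qed.
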